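(* Let a group $G$ act on a bifoliated plane $(P,\mathcal F^+,\mathcal F^-)$ by homeomorphisms preserving each foliation, and suppose the action satisfies (A1), (A3), (A4), (A5) and (A2a) the set of points of $P$ that are fixed by some nontrivial element of $G$ is dense in $P$. Then it satisfies (A2b) the action is topologically transitive, i.e. has a dense orbit. Consequently, an action is a transitive Anosov-like action (it satisfies (A1), (A2a), (A2b), (A3), (A4), (A5)) if and only if it is an Anosov-like action (it satisfies (A1)–(A5)) that also satisfies (A2a).
   Context: A bifoliated plane $(P,\mathcal F^+,\mathcal F^-)$ is a topological plane $P$ with two transverse topological one-dimensional foliations $\mathcal F^\pm$, possibly with isolated prong singularities (points where both foliations have a $p$-prong singularity, $p\ge 3$). The leaf space of $\mathcal F^\pm$ is the quotient of $P$ by the leaves; two distinct leaves are non-separated if they do not admit disjoint neighborhoods in the leaf space. A face of a singular leaf $l$ is a properly embedded line in $l$ bounding a connected component of $P\setminus l$. Disjoint leaves (or faces, or rays) $l^+$ of $\mathcal F^+$ and $l^-$ of $\mathcal F^-$ make a perfect fit if there are arcs $\tau^\pm$ starting at a point of $l^\pm$ and transverse to $\mathcal F^\pm$ such that every leaf of $\mathcal F^+$ meeting the interior of $\tau^+$ intersects $l^-$, and every leaf of $\mathcal F^-$ meeting the interior of $\tau^-$ intersects $l^+$. A totally ideal quadrilateral is an open set $Q\subset P$ bounded by four leaves or faces $l_0,l_2$ of $\mathcal F^+$ and $l_1,l_3$ of $\mathcal F^-$ such that each $l_i$ makes a perfect fit with $l_{i+1}$ (indices mod $4$), and any leaf of $\mathcal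 F^\pm$ intersects $l_i$ if and only if it intersects $l_{i+2}$. The axioms are: (A1) if a nontrivial element of $G$ fixes (setwise) a leaf $l$ of $\mathcal F^\pm$, then it has a fixed point $x\in l$ and is topologically expanding on one leaf through $x$ and topologically contracting on the other; (A2) the union of leaves of $\mathcal F^+$ fixed by some nontrivial element of $G$ is dense in $P$, and likewise for $\mathcal F^-$; (A3) each singular point is fixed by some nontrivial element of $G$; (A4) if $l$ is a leaf of $\mathcal F^+$ or $\mathcal F^-$ that is non-separated from some leaf $l'$ in the corresponding leaf space, then some nontrivial element of $G$ fixes $l$; (A5) there are no totally ideal quadrilaterals in $P$. *)

(* Defs.v *)
From mathcomp Require Import all_boot all_order all_algebra.
From mathcomp Require Import generic_quotient complex.
From mathcomp Require Import all_classical all_reals topology normedtype.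

Set Implicit Arguments.
Unset Strict Implicit.
Unset Printing Implicit Defensive.

Import Order.TTheory GRing.Theory Num.Theory.
Import numFieldNormedType.Exports.

Local Open Scope classical_set_scope.
Local Open Scope ring_scope.
Local Open Scope quotient_scope.

Definition homeomorphism {T U : topologicalType} (A : set T) (B : set U)
    (f : T -> U) : Prop :=
  set_bij A B f /\ {within A, continuous f} /\
  exists g : U -> T, {within B, continuous g} /\ (forall x, A x -> g (f x) = x).

Definition topological_plane (R : realType) (P : topologicalType) : Prop :=
  exists f : P -> (R * R)%type, homeomorphism [set: P] [set: R * R] f.

Definition frontier {T : topologicalType} (A : set T) : set T :=
  closure A `\` interior A.

(* A decomposition of P into leaves is given by the equivalence relation
   "lie on the same leaf". *)
Definition leaf {P : topologicalType} (F : equiv_rel P) (x : P) : set P :=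
  [set y | F x y].

Definition leaf_space {P : topologicalType} (F : equiv_rel P) :
    topologicalType := quotient_topology {eq_quot F}.

Definition nonseparated {T : topologicalType} (a b : T) : Prop :=
  a <> b /\ ~ exists U V : set T,
    [/\ open_nbhs a U, open_nbhs b V & U `&` V = set0].

Definition plaque {P : topologicalType} (F : equiv_rel P) (U : set P)
  (x : P) : set P := connected_component (leaf F x `&` U) x.

Definition level_component {R : realType} (h : R * R -> R) (z : R * R) :
  set (R * R) := connected_component (h @^-1` [set h z]) z.

(* A chart around x, onto the whole of R^2 with x at the origin, that
   simultaneously carries the plaques of Fp to the components of the level sets
   of hp, and those of Fm to the components of the level sets of hm. *)
Definition bifoliated_chart {R : realType} {P : topologicalType}
    (Fp Fm : equiv_rel P) (hp hm : R * R -> R) (x : P) (U : set P)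
    (f : P -> R * R) : Prop :=
  [/\ open_nbhs x U,
      homeomorphism U [set: R * R] f,
      f x = (0, 0),
      forall y, U y -> plaque Fp U y = U `&` f @^-1` level_component hp (f y) &
      forall y, U y -> plaque Fm U y = U `&` f @^-1` level_component hm (f y)].

(* Local product structure: Fp is horizontal and Fm is vertical. *)
Definition regular_point (R : realType) {P : topologicalType}
    (Fp Fm : equiv_rel P) (x : P) : Prop :=
  exists U (f : P -> R * R),
    bifoliated_chart Fp Fm (fun z => z.2) (fun z => z.1) x U f.

(* The standard p-prong singularity at the origin of the complex plane: the two
   foliations by level sets of Im (z^(p/2)) and Re (z^(p/2)).  These functions
   are two-valued for odd p, but
     2 (Im z^(p/2))^2 = |z|^p - Re (z^p),  2 (Re z^(p/2))^2 = |z|^p + Re (z^p),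
   and the components of the level sets of the right-hand sides are the
   leaves; the leaf through 0 is a union of p rays. *)
Definition normXp {R : realType} (p : nat) (z : R * R) : R :=
  Num.sqrt (z.1 ^+ 2 + z.2 ^+ 2) ^+ p.

Definition reXp {R : realType} (p : nat) (z : R * R) : R :=
  complex.Re ((z.1 +i* z.2)%C ^+ p).

Definition prong_point (R : realType) {P : topologicalType}
    (Fp Fm : equiv_rel P) (p : nat) (x : P) : Prop :=
  exists U (f : P -> R * R),
    bifoliated_chart Fp Fm (fun z => normXp p z - reXp p z)
                           (fun z => normXp p z + reXp p z) x U f.

Definition singular_point (R : realType) {P : topologicalType}
    (Fp Fm : equiv_rel P) (x : P) : Prop :=
  exists2 p : nat, (3 <= p)%N & prong_point R Fp Fm p x.

Definition path_connected (R : realType) {P : topologicalType} (A : set P) :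
    Prop :=
  forall x y, A x -> A y -> exists c : R -> P,
    [/\ {within `[0, 1], continuous c}, c 0 = x, c 1 = y &
        forall t, t \in `[0, 1] -> A (c t)].

(* Singular points are automatically isolated: every point of a p-prong chart
   other than its centre is regular. *)
Definition bifoliated_plane (R : realType) (P : topologicalType)
    (Fp Fm : equiv_rel P) : Prop :=
  [/\ topological_plane R P,
      forall x, path_connected R (leaf Fp x),
      forall x, path_connected R (leaf Fm x) &
      forall x, regular_point R Fp Fm x \/ singular_point R Fp Fm x].

Definition proper_line (R : realType) {P : topologicalType} (l : set P) : Prop :=
  exists c : R -> P,
    [/\ continuous c, injective c, range c = l &
        forall K : set P, compact K -> compact (c @^-1` K)].

(* f is a face of a singular leaf of F, where F is one of Fp and Fm. *)
Definition is_face (R : realType) {P : topologicalType} (Fp Fm F : equiv_rel P)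
    (f : set P) : Prop :=
  exists s : P,
    [/\ singular_point R Fp Fm s, f `<=` leaf F s, proper_line R f &
        exists2 a, ~ leaf F s a &
          frontier (connected_component (~` leaf F s) a) = f].

Definition is_leaf {P : topologicalType} (F : equiv_rel P) (l : set P) : Prop :=
  exists x, l = leaf F x.

Definition leaf_or_face (R : realType) {P : topologicalType}
    (Fp Fm F : equiv_rel P) (l : set P) : Prop :=
  is_leaf F l \/ is_face R Fp Fm F l.

(* An arc parametrised by [0, 1] which, near each of its points, meets every
   plaque of F at most once. *)
Definition transverse_arc {R : realType} {P : topologicalType} (F : equiv_rel P)
    (c : R -> P) : Prop :=
  [/\ {within `[0, 1], continuous c},
      {in `[0, 1] &, injective c} &
      forall t, t \in `[0, 1] -> exists (U : set P) (W : set R),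
        [/\ open_nbhs (c t) U, open_nbhs t W &
            forall s s', s \in `[0, 1] -> s' \in `[0, 1] -> W s -> W s' ->
              plaque F U (c s) (c s') -> s = s']].

Definition intersects {T : Type} (A B : set T) : Prop := A `&` B !=set0.

Definition perfect_fit (R : realType) {P : topologicalType}
    (Fp Fm : equiv_rel P) (lp lm : set P) : Prop :=
  lp `&` lm = set0 /\
  exists cp cm : R -> P,
    [/\ transverse_arc Fp cp /\ transverse_arc Fm cm,
        lp (cp 0) /\ lm (cm 0),
        forall t, t \in `]0, 1[ -> intersects (leaf Fp (cp t)) lm &
        forall t, t \in `]0, 1[ -> intersects (leaf Fm (cm t)) lp].

(* A leaf of Fp can only be compared with the two sides in Fm, and a leaf of Fm
   with the two sides in Fp: a side always meets the leaf that contains it. *)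
Definition totally_ideal_quadrilateral (R : realType) {P : topologicalType}
    (Fp Fm : equiv_rel P) (Q l0 l1 l2 l3 : set P) : Prop :=
  [/\ open Q /\ frontier Q = l0 `|` l1 `|` l2 `|` l3,
      [/\ leaf_or_face R Fp Fm Fp l0, leaf_or_face R Fp Fm Fp l2 & l0 <> l2],
      [/\ leaf_or_face R Fp Fm Fm l1, leaf_or_face R Fp Fm Fm l3 & l1 <> l3],
      [/\ perfect_fit R Fp Fm l0 l1, perfect_fit R Fp Fm l2 l1,
          perfect_fit R Fp Fm l2 l3 & perfect_fit R Fp Fm l0 l3] &
      (forall x, intersects (leaf Fm x) l0 <-> intersects (leaf Fm x) l2) /\
      (forall x, intersects (leaf Fp x) l1 <-> intersects (leaf Fp x) l3)].

Record bifoliated_action {P : topologicalType} (Fp Fm : equiv_rel P)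
    (G : groupType) (act : G -> P -> P) : Prop := {
  bact1 : forall x, act 1%g x = x;
  bactM : forall g h x, act (g * h)%g x = act g (act h x);
  bact_continuous : forall g, continuous (act g);
  bact_Fp : forall g x y, Fp (act g x) (act g y) = Fp x y;
  bact_Fm : forall g x y, Fm (act g x) (act g y) = Fm x y }.

Section AnosovLike.
Context (R : realType) (P : topologicalType) (Fp Fm : equiv_rel P).
Context (G : groupType) (act : G -> P -> P).
Implicit Types (F : equiv_rel P) (g : G) (x y : P).

Definition fixes_leaf g F x : Prop := act g @` leaf F x = leaf F x.

(* Contraction of the whole leaf to x.  Leaves are properly embedded, so that
   convergence in P is convergence along the leaf. *)
Definition contracting g F x : Prop :=
  act g x = x /\
  forall y, leaf F x y -> (fun n => iter n (act g) y) @ \oo --> x.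

Definition expanding g F x : Prop := contracting g^-1%g F x.

Definition axiom_A1_for F : Prop :=
  forall g y, g <> 1%g -> fixes_leaf g F y ->
    exists x, [/\ leaf F y x, act g x = x &
      (expanding g Fp x /\ contracting g Fm x) \/
      (contracting g Fp x /\ expanding g Fm x)].

Definition axiom_A1 : Prop := axiom_A1_for Fp /\ axiom_A1_for Fm.

Definition axiom_A2_for F : Prop :=
  dense [set x | exists2 g, g <> 1%g & fixes_leaf g F x].

Definition axiom_A2 : Prop := axiom_A2_for Fp /\ axiom_A2_for Fm.

Definition axiom_A2a : Prop :=
  dense [set x | exists2 g, g <> 1%g & act g x = x].

Definition axiom_A2b : Prop :=
  exists x, dense [set act g x | g in [set: G]].

Definition axiom_A3 : Prop :=
  forall x, singular_point R Fp Fm x -> exists2 g, g <> 1%g & act g x = x.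

Definition axiom_A4_for F : Prop :=
  forall x y,
    nonseparated (\pi_(leaf_space F) x : leaf_space F) (\pi_(leaf_space F) y) ->
    exists2 g, g <> 1%g & fixes_leaf g F x.

Definition axiom_A4 : Prop := axiom_A4_for Fp /\ axiom_A4_for Fm.

Definition axiom_A5 : Prop :=
  ~ exists Q l0 l1 l2 l3, totally_ideal_quadrilateral R Fp Fm Q l0 l1 l2 l3.

Definition anosov_like : Prop :=
  [/\ axiom_A1, axiom_A2, axiom_A3, axiom_A4 & axiom_A5].

Definition transitive_anosov_like : Prop :=
  [/\ axiom_A1, axiom_A2a /\ axiom_A2b, axiom_A3, axiom_A4 & axiom_A5].

End AnosovLike.

(* Main.v *)
Require Import Defs.
From HB Require Import structures.
From mathcomp Require Import all_boot all_order all_algebra.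
From mathcomp Require Import generic_quotient complex ring lra.
From mathcomp Require Import all_classical all_reals topology all_analysis.

(** A point a fixed by a nontrivial element is, by (A1), hyperbolic: some g
    contracts the leaf of Fp through a, and some h contracts the leaf of Fm.
    Hence, if the Fp-leaf of a meets the Fm-leaf of another such point b at w,
    every open invariant set O containing a contains w, and then accumulates
    at b by iterating at b.  Since fixed points are dense by (A2a), the closure
    of O is a neighbourhood of each of its points x around which all Fp-leaves
    meet all Fm-leaves.  Regular points are such; so is every point other than
    the centre of a prong chart, because w = z^(p/2) straightens both
    foliations away from 0.  The punctured chart is connected, so the closure
    of O is open, hence is the whole plane; Baire's theorem then gives a dense
    orbit. *)

Set Implicit Arguments.
Unset Strict Implicit.
Unset Printing Implicit Defensive.
Import Order.TTheory GRing.Theory Num.Theory.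
Import numFieldNormedType.Exports.
Local Open Scope classical_set_scope.
Local Open Scope ring_scope.

Lemma continuous_pair (T U V : topologicalType) (f : T -> U) (g : T -> V) x :
  {for x, continuous f} -> {for x, continuous g} ->
  {for x, continuous (fun y => (f y, g y))}.
Proof. by move=> cf cg; exact: (cvg_pair cf cg). Qed.

(** * The complex exponential on [R * R] and branches of its logarithm *)

Section Exponential.
Context {R : realType}.
Implicit Types (z w u : R * R) (t : R).

Definition cexp u : R * R := (expR u.1 * cos u.2, expR u.1 * sin u.2).

(** Real and imaginary part ([roty]) of [z] multiplied by [exp(-it)]: the direction [t] is turned
    into the positive real axis. *)
Definition rotx t z : R := z.1 * cos t + z.2 * sin t.
Definition roty t z : R := z.2 * cos t - z.1 * sin t.

(** Branch of the logarithm on the half-plane [0 < rotx t z], with argument within [pi / 2] of [t].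
    The first coordinate is [ln |z|], because [rotx t z = |z| cos a]. *)
Definition clog t z : R * R :=
  let a := atan (roty t z / rotx t z) in (ln (rotx t z) - ln (cos a), t + a).

Lemma cexp_continuous : continuous cexp.
Proof.
move=> u; apply: (@continuous_pair _ _ _ (fun u => expR u.1 * cos u.2)
  (fun u => expR u.1 * sin u.2)); apply: cvgM.
- by apply: continuous_comp; [exact: cvg_fst|exact: continuous_expR].
- by apply: continuous_comp; [exact: cvg_snd|exact: continuous_cos].
- by apply: continuous_comp; [exact: cvg_fst|exact: continuous_expR].
- by apply: continuous_comp; [exact: cvg_snd|exact: continuous_sin].
Qed.

Lemma rotx_continuous t : continuous (rotx t).
Proof.
move=> z; apply: cvgD; (apply: cvgM; last exact: cvg_cst).
  exact: cvg_fst.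
exact: cvg_snd.
Qed.

Lemma roty_continuous t : continuous (roty t).
Proof.
move=> z; apply: cvgB; (apply: cvgM; last exact: cvg_cst).
  exact: cvg_snd.
exact: cvg_fst.
Qed.

Lemma cos_atan_gt0 (x : R) : 0 < cos (atan x).
Proof. by apply: cos_gt0_pihalf; rewrite atan_gtNpi2 atan_ltpi2. Qed.

Lemma clog_continuous t z : 0 < rotx t z -> {for z, continuous (clog t)}.
Proof.
move=> x0.
have ca : {for z, continuous (fun z => atan (roty t z / rotx t z))}.
  apply: continuous_comp; last exact: continuous_atan.
  apply: cvgM; first exact: roty_continuous.
  by apply: cvgV; [rewrite gt_eqF|exact: rotx_continuous].
apply: (@continuous_pair _ _ _
  (fun z => ln (rotx t z) - ln (cos (atan (roty t z / rotx t z))))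
  (fun z => t + atan (roty t z / rotx t z))).
  apply: cvgB.
    apply: continuous_comp; first exact: rotx_continuous.
    exact: continuous_ln.
  apply: (@continuous_comp _ _ _
    (fun z : R * R => cos (atan (roty t z / rotx t z))) (@ln R)).
    by apply: continuous_comp; [exact: ca|exact: continuous_cos].
  by apply: continuous_ln; exact: cos_atan_gt0.
by apply: cvgD; [exact: cvg_cst|exact: ca].
Qed.

Lemma clogK t z : 0 < rotx t z -> cexp (clog t z) = z.
Proof.
move=> x0; rewrite /cexp /clog /=; set a := atan _.
have ca : 0 < cos a by exact: cos_atan_gt0.
have sa : sin a = cos a * (roty t z / rotx t z).
  by rewrite -[X in _ = _ * X]atanK -/a /tan mulrCA mulfV ?mulr1 ?gt_eqF.
rewrite expRD expRN !lnK ?posrE // cosD sinD sa.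
have [ca0 x0' cs] : [/\ cos a != 0, rotx t z != 0 & cos t ^+ 2 = 1 - sin t ^+ 2].
  by split; rewrite ?gt_eqF // -(cos2Dsin2 t) addrK.
rewrite [LHS](_ : _ = (rotx t z * cos t - roty t z * sin t,
                       rotx t z * sin t + roty t z * cos t)).
  case: z {x0 a ca sa ca0 x0'} => x y; rewrite /rotx /roty /=.
  congr (_, _); ring: cs.
congr (_, _); field; exact/andP.
Qed.

Lemma rotx_cexp t u : rotx t (cexp u) = expR u.1 * cos (u.2 - t).
Proof. by rewrite /rotx /cexp /= cosB; ring. Qed.

Lemma roty_cexp t u : roty t (cexp u) = expR u.1 * sin (u.2 - t).
Proof. by rewrite /roty /cexp /= sinB; ring. Qed.

Lemma rotx_cexp_gt0 t u : - (pi / 2) < u.2 - t < pi / 2 -> 0 < rotx t (cexp u).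
Proof. by move=> h; rewrite rotx_cexp mulr_gt0 ?expR_gt0 ?cos_gt0_pihalf. Qed.

Lemma cexpK t u : - (pi / 2) < u.2 - t < pi / 2 -> clog t (cexp u) = u.
Proof.
move=> h; rewrite /clog rotx_cexp roty_cexp.
have c0 := cos_gt0_pihalf h.
have -> : expR u.1 * sin (u.2 - t) / (expR u.1 * cos (u.2 - t)) = tan (u.2 - t).
  rewrite /tan; field; by rewrite !gt_eqF ?expR_gt0.
rewrite tanK ?in_itv //= lnM ?posrE ?expR_gt0 // expRK addrK subrKC.
by case: u {h c0}.
Qed.

Lemma cexp_neq0 u : cexp u != 0.
Proof.
apply/eqP => u0; have := rotx_cexp_gt0 (t := u.2) (u := u).
rewrite u0 subrr /rotx /= !mul0r addr0 ltxx => h.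
by apply/notF/h; rewrite oppr_lt0 divr_gt0 ?pi_gt0.
Qed.

(** One of the directions [0], [pi], [pi / 2], [- (pi / 2)] makes an acute angle with [z], and the
    corresponding branch [clog] applies. *)
Lemma cexp_surj z : z != 0 -> exists u, cexp u = z.
Proof.
case: z => x y z0.
suff [t t0] : exists t, 0 < rotx t (x, y) by exists (clog t (x, y)); exact: clogK.
rewrite /rotx /=.
have [x0|x0|x0] := ltrgtP x 0.
- by exists pi; rewrite cospi sinpi; lra.
- by exists 0; rewrite cos0 sin0; lra.
- have [y0|y0|y0] := ltrgtP y 0.
  + by exists (- (pi / 2)); rewrite cosN sinN cos_pihalf sin_pihalf; lra.
  + by exists (pi / 2); rewrite cos_pihalf sin_pihalf; lra.
  + by move: z0; rewrite x0 y0 eqxx.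
Qed.

(** De Moivre's formula, by induction on [p]. *)
Lemma cexpX p u :
  ((cexp u).1 +i* (cexp u).2)%C ^+ p =
  ((cexp (p%:R *: u)).1 +i* (cexp (p%:R *: u)).2)%C.
Proof.
elim: p => [|p IH].
  by rewrite scale0r expr0 /cexp /= cos0 sin0 expR0 mul1r mulr0.
rewrite exprS IH /cexp /=.
have E (x : R) : p.+1%:R *: x = x + p%:R * x.
  by rewrite /GRing.scale /= -natr1 mulrDl mul1r addrC.
rewrite !E /GRing.scale /=.
rewrite expRD cosD sinD.
set a := expR u.1; set b := expR _; set c := cos u.2; set d := sin u.2.
set c' := cos _; set d' := sin _.
rewrite [LHS](_ : _ = (((a * c) * (b * c') - (a * d) * (b * d'))
   +i* ((a * c) * (b * d') + (a * d) * (b * c')))%C) //.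
by congr Complex; ring.
Qed.

Lemma cexpZ (c : R) u :
  cexp (c *: u) = (expR (c * u.1) * cos (c * u.2), expR (c * u.1) * sin (c * u.2)).
Proof. by case: u. Qed.

Lemma normXp_cexp p u : normXp p (cexp u) = expR (p%:R * u.1).
Proof.
rewrite /normXp /cexp /= !exprMn -mulrDr cos2Dsin2 mulr1 sqrtr_sqr.
by rewrite ger0_norm ?expR_ge0 // expRM_natl.
Qed.

Lemma reXp_cexp p u : reXp p (cexp u) = expR (p%:R * u.1) * cos (p%:R * u.2).
Proof. by rewrite /reXp cexpX cexpZ. Qed.

End Exponential.

(** * Crossing of level components in the regular and the prong model *)

Section Prong.
Context {R : realType}.
Implicit Types (z w u : R * R) (t : R).

(* Taking w = z^(p/2) as a new coordinate, the two functions defining the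
   p-prong become 2 (Im w)^2 and 2 (Re w)^2. *)
Lemma prong_levelE p u :
  normXp p (cexp u) - reXp p (cexp u) = 2 * (cexp ((p%:R / 2) *: u)).2 ^+ 2 /\
  normXp p (cexp u) + reXp p (cexp u) = 2 * (cexp ((p%:R / 2) *: u)).1 ^+ 2.
Proof.
rewrite normXp_cexp reXp_cexp cexpZ.
have dbl (x : R) : p%:R * x = p%:R / 2 * x + p%:R / 2 * x by field.
rewrite (dbl u.1) (dbl u.2) expRD cosD.
have := cos2Dsin2 (p%:R / 2 * u.2).
move: (cos _) (sin _) (expR _) => c d e /= cs.
have {}cs : c ^+ 2 = 1 - d ^+ 2 by rewrite -cs addrK.
split; ring: cs.
Qed.

Lemma level_component_path (h : R * R -> R) (c : R -> R * R) :
  (forall t, 0 <= t <= 1 -> {for t, continuous c}) ->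
  (forall t, 0 <= t <= 1 -> h (c t) = h (c 0)) ->
  level_component h (c 0) (c 1).
Proof.
move=> cc hc; rewrite /level_component.
apply: (@connected_component_max _ _ (c @` `[0, 1])).
- by exists 0 => //=; rewrite in_itv /= lexx ler01.
- by move=> _ [t /= + <-]; rewrite in_itv /= => /hc.
- apply: connected_continuous_connected; first exact: segment_connected.
  apply: continuous_in_subspaceT => t; rewrite inE /= in_itv /=; exact: cc.
- by exists 1 => //=; rewrite in_itv /= lexx ler01.
Qed.



Lemma ball_convex (c e a b t : R) :
  0 <= t <= 1 -> ball c e a -> ball c e b -> ball c e (a + t * (b - a)).
Proof.
rewrite -ball_normE /ball_ /= !ltr_norml => /andP[t0 t1] /andP[a1 a2] /andP[b1 b2].
have [ab|ba] := leP a b.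
  have [h1 h2] : 0 <= t * (b - a) /\ 0 <= (1 - t) * (b - a).
    by split; apply: mulr_ge0; rewrite ?subr_ge0.
  by apply/andP; split; lra.
have [h1 h2] : 0 <= t * (a - b) /\ 0 <= (1 - t) * (a - b).
  by split; apply: mulr_ge0; rewrite ?subr_ge0 // ltW.
by apply/andP; split; lra.
Qed.

Lemma segment_continuous (a b t : R) : {for t, continuous (fun t => a + t * (b - a))}.
Proof.
by apply: cvgD; [exact: cvg_cst|apply: cvgM; [exact: cvg_id|exact: cvg_cst]].
Qed.

Lemma continuous_scale (f : R * R -> R * R) k z :
  {for z, continuous f} -> {for z, continuous (fun z => k *: f z)}.
Proof. by move=> fz; apply: cvgZ; [exact: cvg_cst|exact: fz]. Qed.

Lemma regular_level_cross z1 z2 : exists w,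
  level_component (fun z => z.2) z1 w /\ level_component (fun z => z.1) z2 w.
Proof.
(* The corner where the horizontal line through [z1] meets the vertical line through [z2]. *)
exists (z2.1, z1.2); split.
  pose c t := (z1.1 + t * (z2.1 - z1.1), z1.2).
  have -> : (z2.1, z1.2) = c 1 by rewrite /c mul1r addrC subrK.
  have -> : z1 = c 0 by rewrite /c mul0r addr0; case: (z1).
  apply: level_component_path => // t _.
  apply: (@continuous_pair _ _ _ (fun t => z1.1 + t * (z2.1 - z1.1))).
    exact: segment_continuous.
  exact: cvg_cst.
pose c t := (z2.1, z2.2 + t * (z1.2 - z2.2)).
have -> : (z2.1, z1.2) = c 1 by rewrite /c mul1r addrC subrK.
have -> : z2 = c 0 by rewrite /c mul0r addr0; case: (z2).
apply: level_component_path => // t _.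
apply: (@continuous_pair _ _ _ _ (fun t => z2.2 + t * (z1.2 - z2.2))).
  exact: cvg_cst.
exact: segment_continuous.
Qed.

(** Near [z0] a branch [W] of [z^(p/2)] has a local inverse [Z], which sends horizontal and vertical
    segments into level components of the two functions; crossing is thus reduced to the regular
    model. *)
Lemma prong_level_cross p z0 : (0 < p)%N -> z0 != 0 ->
  exists2 N, nbhs z0 N & forall z1 z2, N z1 -> N z2 -> exists w,
    level_component (fun z => normXp p z - reXp p z) z1 w /\
    level_component (fun z => normXp p z + reXp p z) z2 w.
Proof.
move=> p0 /cexp_surj[u0 <-]; pose k : R := p%:R / 2.
have k0 : k != 0 by rewrite mulf_neq0 ?invr_eq0 ?pnatr_eq0 ?lt0n_neq0.
have pi0 : - (pi / 2) < (0 : R) < pi / 2 by rewrite oppr_lt0 andbb divr_gt0 ?pi_gt0.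
(* [t0] and [t1] are arguments of [z0] and of [w0 = z0^(p/2)]; the branches defining [W] and [Z] are
   centred at them. *)
pose t0 := u0.2; pose t1 := (k *: u0).2; pose w0 := cexp (k *: u0).
pose W z := cexp (k *: clog t0 z); pose Z w := cexp (k^-1 *: clog t1 w).
have rw0 : 0 < rotx t1 w0 by apply: rotx_cexp_gt0; rewrite subrr.
have rz0 : 0 < rotx t0 (cexp u0) by apply: rotx_cexp_gt0; rewrite subrr.
(* On this ball [clog t1] is a continuous logarithm, hence [Z] is continuous there and [levels]
   holds. *)
have [e /= e0 eH] : nbhs_ball w0 [set w | 0 < rotx t1 w].
  by apply/nbhs_ballP; exact: (cvgr_gt _ (@rotx_continuous _ t1 w0)).
have Zcont w : ball w0 e w -> {for w, continuous Z}.
  move=> /eH wH; apply: (@continuous_comp _ _ _ (fun w => k^-1 *: clog t1 w) cexp).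
    by apply: continuous_scale; exact: clog_continuous.
  exact: cexp_continuous.
have levels w : ball w0 e w ->
    normXp p (Z w) - reXp p (Z w) = 2 * w.2 ^+ 2 /\
    normXp p (Z w) + reXp p (Z w) = 2 * w.1 ^+ 2.
  move=> /eH wH; have := prong_levelE p (k^-1 *: clog t1 w).
  by rewrite -/k scalerA divff // scale1r clogK.
(* The last condition keeps the argument of [W z] within reach of the branch at [t1], so that
   [clog t1] recovers [k *: clog t0 z] and [Z] inverts [W]. *)
pose N := [set z | [/\ 0 < rotx t0 z, ball w0 e (W z) &
  - (pi / 2) < (k *: clog t0 z).2 - t1 < pi / 2]].
have ZW z : N z -> Z (W z) = z.
  by move=> [zx _ zpi]; rewrite /Z /W cexpK // scalerA mulVf // scale1r clogK.
exists N.
  have kc : {for cexp u0, continuous (fun z => k *: clog t0 z)}.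
    by apply: continuous_scale; exact: clog_continuous.
  have Wc : {for cexp u0, continuous W}.
    by exact: (continuous_comp kc (@cexp_continuous _ _)).
  have Ac : {for cexp u0, continuous (fun z => (k *: clog t0 z).2 - t1)}.
    apply: cvgB; last exact: cvg_cst.
    by apply: (continuous_comp kc); exact: cvg_snd.
  have u0K : clog t0 (cexp u0) = u0 by rewrite cexpK ?subrr.
  have Wu0 : W (cexp u0) = w0 by rewrite /W u0K.
  have AE : (k *: clog t0 (cexp u0)).2 - t1 = 0 by rewrite u0K subrr.
  have {}Ac : (k *: clog t0 z).2 - t1 @[z --> cexp u0] -->
    (k *: clog t0 (cexp u0)).2 - t1 := Ac.
  near=> z; split.
  - by near: z; exact: (cvgr_gt _ (@rotx_continuous _ t0 (cexp u0))).
  - near: z; apply: Wc; rewrite Wu0; exact: nbhsx_ballx.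
  - apply/andP; split; near: z.
      by apply: (cvgr_gt _ Ac); rewrite AE; case/andP: pi0.
    by apply: (cvgr_lt _ Ac); rewrite AE; case/andP: pi0.
move=> z1 z2 N1 N2; have [_ [b11 b12] _] := N1; have [_ [b21 b22] _] := N2.
(* Balls of [R * R] are products of intervals, so the corner and the segments joining it to [W z1]
   and [W z2] stay in the ball. *)
exists (Z ((W z2).1, (W z1).2)); split.
  pose c t := ((W z1).1 + t * ((W z2).1 - (W z1).1), (W z1).2).
  have cb t : 0 <= t <= 1 -> ball w0 e (c t).
    by move=> ?; split => //=; exact: ball_convex.
  have c1 : ((W z2).1, (W z1).2) = c 1 by rewrite /c mul1r addrC subrK.
  have c0 : W z1 = c 0 by rewrite /c mul0r addr0; case: (W z1).
  rewrite -{1}(ZW z1) // c1 c0; apply: (level_component_path (c := Z \o c)) => t ht.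
    apply: continuous_comp; last by apply: Zcont; exact: cb.
    apply: (@continuous_pair _ _ _ (fun t => (W z1).1 + t * ((W z2).1 - (W z1).1))).
      exact: segment_continuous.
    exact: cvg_cst.
  have [-> _] := levels _ (cb _ ht).
  by have [|-> _] := levels (c 0); first by rewrite -c0.
pose c t := ((W z2).1, (W z2).2 + t * ((W z1).2 - (W z2).2)).
have cb t : 0 <= t <= 1 -> ball w0 e (c t).
  by move=> ?; split => //=; exact: ball_convex.
have c1 : ((W z2).1, (W z1).2) = c 1 by rewrite /c mul1r addrC subrK.
have c0 : W z2 = c 0 by rewrite /c mul0r addr0; case: (W z2).
rewrite -{1}(ZW z2) // c1 c0; apply: (level_component_path (c := Z \o c)) => t ht.
  apply: continuous_comp; last by apply: Zcont; exact: cb.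
  apply: (@continuous_pair _ _ _ _ (fun t => (W z2).2 + t * ((W z1).2 - (W z2).2))).
    exact: cvg_cst.
  exact: segment_continuous.
have [_ ->] := levels _ (cb _ ht).
by have [|_ ->] := levels (c 0); first by rewrite -c0.
Unshelve. all: by end_near. Qed.

End Prong.

(** * Completeness and a countable base of [R * R], for Baire's theorem *)

HB.instance Definition _ (U V : puniformType) := Pointed.on (U * V)%type.

(** Both projections of a Cauchy filter are Cauchy, and the pair of their limits is a limit of the
    filter. *)
Lemma prod_complete (U V : completeType) (F : set_system (U * V)) :
  ProperFilter F -> cauchy F -> cvg F.
Proof.
move=> FF Fc.
have F1 : cauchy (fst @ F).
  move=> A A_ent; rewrite near_simpl -near2E near_map2; apply: Fc.
  exists (A, setT); first by split => //; exact: filterT.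
  by move=> [[a b] [c d]] /= [Aab _]; exists ((a, c), (b, d)).
have F2 : cauchy (snd @ F).
  move=> A A_ent; rewrite near_simpl -near2E near_map2; apply: Fc.
  exists (setT, A); first by split => //; exact: filterT.
  by move=> [[a b] [c d]] /= [_ Aab]; exists ((a, c), (b, d)).
apply/cvg_ex; exists ((lim (fst @ F), lim (snd @ F)) : U * V).
have := cvg_pair (cauchy_cvg _ F1) (cauchy_cvg _ F2).
have -> : (fun x : U * V => (x.1, x.2)) = id by apply: funext => -[].
by apply; exact: _.
Qed.

HB.instance Definition _ (U V : completeType) :=
  Uniform_isComplete.Build (U * V)%type (@prod_complete U V).

HB.instance Definition _ (K : realType) (U V : completeNormedModType K) :=
  Uniform_isComplete.Build (U * V)%type (@prod_complete U V).

(** Half of the radius [e] pays for moving the centre to a rational point, the other half for the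
    radius of the new ball. *)
Lemma rational_ball_basis (R : realType) (O : set (R * R)) (z : R * R) :
  nbhs z O ->
  exists q : rat * rat * nat,
    ball ((ratr q.1.1, ratr q.1.2) : R * R) q.2.+1%:R^-1 `<=` O.
Proof.
move=> /nbhs_ballP[e /= e0 eO].
have e2 : 0 < e / 2 by rewrite divr_gt0.
have [k] := ltr_add_invr e2; rewrite add0r; set r : R := _^-1 => re.
have near_rat (x : R) : exists q, ball x (e / 2) (ratr q).
  have [|q] := @rat_in_itvoo R x (x + e / 2); first by rewrite ltrDl.
  rewrite in_itv /= => /andP[xq qe]; exists q.
  by rewrite -ball_normE /ball_ /= ltr_norml; apply/andP; split; lra.
have [q1 q1P] := near_rat z.1; have [q2 q2P] := near_rat z.2.
exists (q1, q2, k) => y /(le_ball (ltW re)) qy; apply: eO.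
have zq : ball z (e / 2) ((ratr q1, ratr q2) : R * R) by split.
exact: ball_split zq qy.
Qed.

(** * Inverses of charts and connectedness of the plane *)

Section Charts.
Context {R : realType} {P : topologicalType}.
Implicit Types (U : set P) (f : P -> R * R).

(** Surjectivity turns the left inverse into a two-sided one with values in [U]; openness of [U]
    turns continuity within [U] into continuity at its points. *)
Lemma homeomorphism_inverse U f : open U -> homeomorphism U setT f ->
  {in U, continuous f} /\
  exists g : R * R -> P,
    [/\ continuous g, forall x, U x -> g (f x) = x,
        forall z, U (g z) & forall z, f (g z) = z].
Proof.
move=> oU [[_ _ fsurj] [fc [g [gc gK]]]]; split.
  by rewrite -continuous_open_subspace.
exists g; split => //.
- exact/continuous_subspace_setT.
- by move=> z; have [x Ux <-] := fsurj z I; rewrite gK.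
- by move=> z; have [x Ux <-] := fsurj z I; rewrite gK.
Qed.

(** The segment from a point of [A] to [b] pulls [A] back to a nonempty clopen part of [[0, 1]]. *)
Lemma plane_clopen (A : set (R * R)) : open A -> closed A -> A !=set0 -> A = setT.
Proof.
move=> oA cA [a Aa]; apply/seteqP; split => // b _.
pose c t := (a.1 + t * (b.1 - a.1), a.2 + t * (b.2 - a.2)).
have cc : continuous c.
  move=> t; have [c1 c2] := (@segment_continuous R a.1 b.1 t, @segment_continuous R a.2 b.2 t).
  exact: (continuous_pair c1 c2).
suff -> : b = c 1.
  suff E : `[0, 1] `&` c @^-1` A = `[0, 1]%classic :> set R.
    by have [] : (`[0, 1] `&` c @^-1` A) 1 by rewrite E /= in_itv /= lexx ler01.
  apply: (@segment_connected R 0 1).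
  - exists 0; split; first by rewrite /= in_itv /= lexx ler01.
    by rewrite /c /preimage /= !mul0r !addr0 -surjective_pairing.
  - by exists (c @^-1` A) => //; apply: open_comp => // ? _; exact: cc.
  - by exists (c @^-1` A) => //; apply: closed_comp => // ? _; exact: cc.
by rewrite /c !mul1r ![_ + (_ - _)]addrC !subrK -surjective_pairing.
Qed.

End Charts.

(** * Points near which leaves of the two foliations cross *)

Section Action.
Context {R : realType} {P : topologicalType} {Fp Fm : equiv_rel P}.

(** A weak form of local product structure: whole leaves are compared, and [w] may lie outside
    [N]. *)
Definition crossing_point (x : P) : Prop :=
  exists2 N, nbhs x N &
    forall a b, N a -> N b -> exists w, leaf Fp a w /\ leaf Fm b w.

(** Level components correspond to plaques, which lie in leaves. The point [y] need not be the
    centre of the chart, which gives access to the punctured prong charts. *)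
Lemma chart_crossing (hp hm : R * R -> R) x U (f : P -> R * R) y M :
  bifoliated_chart Fp Fm hp hm x U f -> U y -> nbhs (f y) M ->
  (forall z1 z2, M z1 -> M z2 ->
     exists w, level_component hp z1 w /\ level_component hm z2 w) ->
  crossing_point y.
Proof.
move=> [[oU _] hf _ pp pm] Uy My Mcross.
have [fc [g [_ gK Ug fK]]] := homeomorphism_inverse oU hf.
exists (U `&` f @^-1` M).
  apply: filterI; first exact: open_nbhs_nbhs.
  by apply: fc => //; rewrite inE.
move=> a b [Ua Ma] [Ub Mb]; have [w [w1 w2]] := Mcross _ _ Ma Mb.
exists (g w); split.
  have : plaque Fp U a (g w) by rewrite pp //; split => //=; rewrite /preimage /= fK.
  by move/connected_component_sub => [].
have : plaque Fm U b (g w) by rewrite pm //; split => //=; rewrite /preimage /= fK.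
by move/connected_component_sub => [].
Qed.

Lemma regular_crossing x : regular_point R Fp Fm x -> crossing_point x.
Proof.
move=> [U [f ch]]; have [[oU Ux] _ _ _ _] := ch.
apply: (chart_crossing ch Ux filterT) => z1 z2 _ _.
exact: regular_level_cross.
Qed.

End Action.

Lemma origin_not_isolated (R : realType) (A : set (R * R)) :
  nbhs (0 : R * R) A -> exists2 z, A z & z != 0.
Proof.
move=> /nbhs_ballP[e /= e0 eA]; exists (e / 2, 0).
  apply: eA; split; rewrite -ball_normE /ball_ /= sub0r normrN.
    by rewrite gtr0_norm; lra.
  by rewrite normr0.
by apply/eqP => -[] /eqP; rewrite gt_eqF // divr_gt0.
Qed.

(** * Density of invariant open sets and existence of a dense orbit *)

Section Action.
Context {R : realType} {P : topologicalType} {Fp Fm : equiv_rel P}.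
Context {G : groupType} {act : G -> P -> P}.
Context (hP : bifoliated_plane R Fp Fm) (hact : bifoliated_action Fp Fm act).

Let actK g x : act g^-1%g (act g x) = x.
Proof. by rewrite -(bactM hact) mulVg (bact1 hact). Qed.

Let actVK g x : act g (act g^-1%g x) = x.
Proof. by rewrite -(bactM hact) mulgV (bact1 hact). Qed.

Let plane_inverse : exists (f : P -> R * R) (g : R * R -> P),
  [/\ continuous f, continuous g, cancel f g & cancel g f].
Proof.
have [[f hf] _ _ _] := hP.
have [fc [g [gc gK _ fK]]] := homeomorphism_inverse openT hf.
exists f, g; split => //.
- by move=> x; apply: fc; rewrite inE.
- by move=> x; exact: gK.
Qed.

Lemma plane_hausdorff : hausdorff_space P.
Proof.
have [f [g [fc gc fK gK]]] := plane_inverse.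
move=> x y xy; apply: (can_inj fK); apply: norm_hausdorff => A B.
move=> /fc fA /fc fB; have [z [zA zB]] := xy _ _ fA fB.
by exists (f z).
Qed.

Definition nontrivially_fixed (x : P) : Prop := exists2 g, g <> 1%g & act g x = x.

Lemma fixes_leaf_of_fixed (F : equiv_rel P) g x :
  (forall g x y, F (act g x) (act g y) = F x y) -> act g x = x ->
  fixes_leaf act g F x.
Proof.
move=> FG gx; have gV : act g^-1%g x = x by rewrite -{1}gx actK.
apply/seteqP; split => [_ [y xy <-]|y xy]; rewrite /leaf /=.
  by rewrite -[x in F x _]gx FG.
exists (act g^-1%g y); last by rewrite actVK.
by rewrite /leaf /= -[x in F x _]gV FG.
Qed.

(** (A1) gives some hyperbolic fixed point [y] on the Fp-leaf of [x]. As [g] or its inverse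
    contracts this leaf to [y] and fixes [x], the constant orbit of [x] converges to [y], so
    [x = y]. *)
Lemma fixed_hyperbolic x : axiom_A1 Fp Fm act -> nontrivially_fixed x ->
  exists g, contracting act g Fp x /\ expanding act g Fm x.
Proof.
move=> [A1 _] [g g1 gx].
have gV : act g^-1%g x = x by rewrite -{1}gx actK.
have fix_leaf := fixes_leaf_of_fixed (bact_Fp hact) gx.
have iterx h : act h x = x -> (fun n => iter n (act h) x) = fun=> x.
  by move=> hx; apply/funext; elim=> //= n ->.
have const_eq y h : act h x = x -> leaf Fp y x -> contracting act h Fp y -> x = y.
  move=> hx yx [_ /(_ x yx)]; rewrite (iterx _ hx) => xy.
  by apply: (cvg_unique plane_hausdorff) xy; exact: cvg_cst.
have [y [xy gy [[ey cy]|[cy ey]]]] := A1 g x g1 fix_leaf.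
- have yx : leaf Fp y x by rewrite /leaf /= generic_quotient.equiv_sym.
  have xE := const_eq y _ gV yx ey; subst y.
  by exists g^-1%g; split => //; rewrite /expanding invgK.
- have yx : leaf Fp y x by rewrite /leaf /= generic_quotient.equiv_sym.
  have xE := const_eq y _ gx yx cy; subst y.
  by exists g.
Qed.

(** Some iterate of [w] enters [O], and invariance under [g^-1] brings it back to [w]. *)
Lemma invariant_contracting (O : set P) F g a w :
  (forall g x, O x -> O (act g x)) ->
  nbhs a O -> contracting act g F a -> leaf F a w -> O w.
Proof.
move=> Oinv Oa [_ ga] /ga /(_ O Oa)[n _ /(_ n (leqnn n))] /=.
elim: n => //= n IH /(Oinv g^-1%g); rewrite actK; exact: IH.
Qed.

Lemma invariant_dense (O : set P) : axiom_A1 Fp Fm act -> axiom_A2a act ->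
  open O -> O !=set0 -> (forall g x, O x -> O (act g x)) -> dense O.
Proof.
move=> A1 A2a oO O0 Oinv.
(* Contraction to [a] puts [w] in [O]; contraction to [b] along its Fm-leaf then moves [w] into [B]
   without leaving [O]. *)
have link a b w B : nontrivially_fixed a -> nontrivially_fixed b -> O a ->
    nbhs b B -> leaf Fp a w -> leaf Fm b w -> O `&` B !=set0.
  move=> /(fixed_hyperbolic A1)[g [ga _]] /(fixed_hyperbolic A1)[h [_ hb]] Oa Bb aw bw.
  have Ow : O w by exact: invariant_contracting Oinv (open_nbhs_nbhs (conj oO Oa)) ga aw.
  have [_ /(_ w bw) /(_ B Bb)[n _ /(_ n (leqnn n)) Bn]] := hb.
  exists (iter n (act h^-1%g) w); split => //.
  by elim: n {Bn} => //= n; exact: Oinv.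
have crossing_closure x : crossing_point (Fp := Fp) (Fm := Fm) x -> closure O x ->
    nbhs x (closure O).
  move=> [N Nx Ncross] Ox.
  have Nx' := nbhs_interior Nx.
  have [u [Ou Nu]] := Ox _ Nx'.
  have [a [[Oa Na] afix]] := A2a (O `&` N^°) (ex_intro _ u (conj Ou Nu))
    (openI oO (open_interior N)).
  (* The point [a] in [O] stays fixed while [b] is chosen by (A2a) arbitrarily near any [y] in the
     interior of [N]. *)
  apply: filterS Nx' => y Ny B By.
  have [b [[Bb Nb] bfix]] := A2a (B^° `&` N^°)
    (ex_intro _ y (conj (nbhs_singleton (nbhs_interior By)) Ny))
    (openI (open_interior B) (open_interior N)).
  have [w [aw bw]] := Ncross _ _ (interior_subset Na) (interior_subset Nb).
  exact: link afix bfix Oa Bb aw bw.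
have singular_closure x : singular_point R Fp Fm x -> closure O x -> nbhs x (closure O).
  move=> [p p3 [U [f ch]]] Ox.
  have [[oU Ux] hf fx _ _] := ch.
  have [fc [g [gc gK Ug fK]]] := homeomorphism_inverse oU hf.
  have gclosed : closed (g @^-1` closure O).
    by apply: closed_comp => [? _|]; [exact: gc|exact: closed_closure].
  have gcross z : z != 0 -> crossing_point (Fp := Fp) (Fm := Fm) (g z).
    move=> z0; have [N zN Ncross] := prong_level_cross (ltnW (ltnW p3)) z0.
    by apply: (chart_crossing ch (Ug z) _ Ncross); rewrite fK.
  (* The exponential maps the connected plane onto the punctured chart, so [plane_clopen] for [A]
     does the work of connectedness of the punctured plane. *)
  pose A := cexp @^-1` (g @^-1` closure O) : set (R * R).
  have A0 : A !=set0.
    have [v [Ov Uv]] := Ox _ (open_nbhs_nbhs (conj oU Ux)).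
    have goO : nbhs (f v) (g @^-1` O).
      by apply: gc; rewrite gK //; exact: open_nbhs_nbhs.
    (* If [O] was met only at the centre of the chart, openness gives another point of [O] off the
       centre. *)
    have [z0 Oz0 /cexp_surj[u uz0]] : exists2 z, (g @^-1` O) z & z != 0.
      have [fo0|fo0] := eqVneq (f v) 0; last by exists (f v) => //; exact: nbhs_singleton.
      by apply: origin_not_isolated; rewrite -fo0.
    by exists u; rewrite /A /= /preimage /= uz0; exact: subset_closure.
  have AT : A = setT.
    apply: plane_clopen => //.
      rewrite openE => u Au; apply: cexp_continuous.
      by apply: gc; apply: crossing_closure => //; apply: gcross; exact: cexp_neq0.
    by apply: closed_comp => // ? _; exact: cexp_continuous.
  apply: filterS (open_nbhs_nbhs (conj oU Ux)) => y Uy; rewrite -(gK y Uy).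
  (* The centre is [x] itself, which lies in the closure by assumption. *)
  have [->|/cexp_surj[u <-]] := eqVneq (f y) 0; first by rewrite -[0]fx gK.
  by have : A u by rewrite AT.
have closure_open : open (closure O).
  rewrite openE => x Ox; have [_ _ _ /(_ x)[/regular_crossing|]] := hP.
    by move=> cx; exact: crossing_closure.
  by move=> sx; exact: singular_closure.
have [f [g [fc gc fK gK]]] := plane_inverse.
have gT : g @^-1` closure O = setT.
  apply: plane_clopen.
  - by apply: open_comp => // ? _; exact: gc.
  - by apply: closed_comp => [? _|]; [exact: gc|exact: closed_closure].
  - have [v Ov] := O0; exists (f v); rewrite /preimage /= fK; exact: subset_closure.
move=> B [b Bb] oB.
have Ob : closure O b by rewrite -(fK b); have : (g @^-1` closure O) (f b) by rewrite gT.
by rewrite setIC; apply: Ob; exact: open_nbhs_nbhs.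
Qed.

(** [V q] consists of the points whose orbit enters the basic open set of index [q]. It is open,
    nonempty and invariant, hence dense; a point in all the [V q] has a dense orbit. *)
Lemma dense_orbit_of_transitive :
  (forall O : set P, open O -> O !=set0 ->
     (forall g x, O x -> O (act g x)) -> dense O) ->
  axiom_A2b act.
Proof.
move=> trans; have [f [g [fc gc fK gK]]] := plane_inverse.
pose D (q : rat * rat * nat) : set (R * R) :=
  interior (ball ((ratr q.1.1, ratr q.1.2) : R * R) q.2.+1%:R^-1).
have oD q : open (D q) by exact: open_interior.
have D0 q : D q !=set0.
  by exists (ratr q.1.1, ratr q.1.2); apply: nbhsx_ballx; rewrite invr_gt0.
pose V q : set P := [set x | exists h, D q (f (act h x))].
have oV q : open (V q).
  rewrite openE => x [h hx].
  have fh : {for x, continuous (f \o act h)}.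
    by apply: continuous_comp; [exact: (bact_continuous hact)|exact: fc].
  have : nbhs x ((f \o act h) @^-1` D q) by apply: fh; exact: open_nbhs_nbhs.
  by apply: filterS => y hy; exists h.
have dV q : dense (V q).
  apply: trans => //.
    have [z Dz] := D0 q; exists (g z); exists 1%g; by rewrite (bact1 hact) gK.
  move=> h x [k kx]; exists (k * h^-1)%g.
  by rewrite -(bactM hact) -mulgA mulVg mulg1.
(* Baire's theorem wants a sequence in [R * R]: the [V q] are transported by [g] and enumerated
   through [pickle], and a number that codes no [q] gives the whole plane. *)
pose E n : set (R * R) :=
  if unpickle n is Some q then g @^-1` V q else setT.
have /Baire : forall n, open (E n) /\ dense (E n).
  move=> n; rewrite /E; case: (unpickle n) => [q|]; last first.
    by split; [exact: openT|move=> O [v Ov] _; exists v].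
  split; first by apply: open_comp => // ? _; exact: gc.
  move=> O [v Ov] oO.
  have [x [Ox Vx]] : (f @^-1` O) `&` V q !=set0.
    apply: dV; first by exists (g v); rewrite /preimage /= gK.
    by apply: open_comp => // ? _; exact: fc.
  by exists (f x); split => //; rewrite /preimage /= fK.
move=> /(_ setT (ex_intro _ 0 I) openT)[z [_ Ez]].
exists (g z) => O [v Ov] oO.
have [q qO] : exists q : rat * rat * nat,
    ball ((ratr q.1.1, ratr q.1.2) : R * R) q.2.+1%:R^-1 `<=` g @^-1` O.
  apply: (@rational_ball_basis _ _ (f v)); apply: gc; rewrite fK.
  exact: open_nbhs_nbhs.
have := Ez (pickle q) I; rewrite /E pickleK => -[h hz].
exists (act h (g z)); split; last by exists h.
by have := qO _ (interior_subset hz); rewrite /preimage /= fK.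
Qed.

End Action.

(** * Comparison of the two systems of axioms *)

Theorem corollary1p11 (R : realType) (P : topologicalType) (Fp Fm : equiv_rel P)
    (hP : bifoliated_plane R Fp Fm)
    (G : groupType) (act : G -> P -> P)
    (hact : bifoliated_action Fp Fm act) :
  (axiom_A1 Fp Fm act -> axiom_A2a act -> axiom_A3 R Fp Fm act ->
     axiom_A4 Fp Fm act -> axiom_A5 R Fp Fm -> axiom_A2b act) /\
  (transitive_anosov_like R Fp Fm act <->
     anosov_like R Fp Fm act /\ axiom_A2a act).
Proof.
have transitive : axiom_A1 Fp Fm act -> axiom_A2a act -> axiom_A2b act.
  move=> A1 A2a; apply: (dense_orbit_of_transitive hP hact) => O oO O0 Oinv.
  exact: (invariant_dense hP hact).
split; first by move=> A1 A2a _ _ _; exact: transitive.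
split=> [[A1 [A2a A2b] A3 A4 A5]|[[A1 A2 A3 A4 A5] A2a]]; last first.
  by have A2b := transitive A1 A2a.
(* An element fixing a point fixes both leaves through it, so (A2a) yields (A2). *)
suff A2 : axiom_A2 Fp Fm act by [].
by split=> O O0 oO; have [x [Ox [g g1 gx]]] := A2a O O0 oO; exists x; split=> //;
  exists g => //; apply: (fixes_leaf_of_fixed hact _ gx);
  case: hact.
Qed.
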